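(* Consider the orthonormal frame gradient flow in generalised rotational form, $\partial_t\mathbf{p}=\mathbf{p}\mathbf{A}$ with $\mathbf{p}=(\boldsymbol{n}_1,\boldsymbol{n}_2,\boldsymbol{n}_3)\in SO(3)$ and $$\mathbf{A}=\begin{pmatrix}0&\frac1{\chi_3}\mathscr{L}_3\mathcal{F}_{Bi}[\mathbf{p}]&-\frac1{\chi_2}\mathscr{L}_2\mathcal{F}_{Bi}[\mathbf{p}]\\[2pt]-\frac1{\chi_3}\mathscr{L}_3\mathcal{F}_{Bi}[\mathbf{p}]&0&\frac1{\chi_1}\mathscr{L}_1\mathcal{F}_{Bi}[\mathbf{p}]\\[2pt]\frac1{\chi_2}\mathscr{L}_2\mathcal{F}_{Bi}[\mathbf{p}]&-\frac1{\chi_1}\mathscr{L}_1\mathcal{F}_{Bi}[\mathbf{p}]&0\end{pmatrix}.$$ Let $\tau>0$ be the time step (of arbitrary size), let $\mathbf{p}^n\in SO(3)$ pointwise in $\Omega$, and let $\mathbf{p}^{n+1}$ satisfy the generalised rotational discrete gradient (gRdg) scheme $$\frac{\mathbf{p}^{n+1}-\mathbf{p}^n}{\tau}=\mathbf{p}^{n+\frac12}\mathbf{A}^{n+\frac12},\qquad \mathbf{p}^{n+\frac12}=\frac{\mathbf{p}^{n+1}+\mathbf{p}^n}{2},$$ $$\mathbf{A}^{n+\frac12}=\begin{pmatrix}0&\frac1{\chi_3}\ell_3&-\frac1{\chi_2}\ell_2\\[2pt]-\frac1{\chi_3}\ell_3&0&\frac1{\chi_1}\ell_1\\[2pt]\frac1{\chi_2}\ell_2&-\frac1{\chi_1}\ell_1&0\end{pmatrix},\qquad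 \ell_i=(\mathscr{L}_i\mathcal{F}_{Bi}[\mathbf{p}])^{n+\frac12}:=\mathbf{V}_i^{n+\frac12}\cdot D_{\mathcal{F}}(\mathbf{p})\big|^{n+\frac12},\quad i=1,2,3,$$ where $D_{\mathcal{F}}(\mathbf{p})|^{n+\frac12}$ is a second-order approximation of the variational derivative $\delta\mathcal{F}_{Bi}[\mathbf{p}]/\delta\mathbf{p}$ satisfying the energy difference relation $$\int_\Omega D_{\mathcal{F}}(\mathbf{p})\big|^{n+\frac12}\cdot(\mathbf{p}^{n+1}-\mathbf{p}^n)\,dV=\mathcal{F}_{Bi}[\mathbf{p}^{n+1}]-\mathcal{F}_{Bi}[\mathbf{p}^n].$$ Then: (i) the scheme is $SO(3)$-preserving: $\mathbf{p}^{n+1}\in SO(3)$ pointwise; (ii) the scheme satisfies the discrete energy dissipation law, i.e. the discrete counterpart of the continuous law $\frac{d}{dt}\mathcal{F}_{Bi}[\mathbf{p}]=-\sum_{k=1}^3\frac1{\chi_k}\|\mathscr{L}_k\mathcal{F}_{Bi}[\mathbf{p}]\|_{L^2}^2\le0$: $$\frac{\mathcal{F}_{Bi}[\mathbf{p}^{n+1}]-\mathcal{F}_{Bi}[\mathbf{p}^n]}{\tau}=-\sum_{k=1}^3\frac1{\chi_k}\Big\|(\mathscr{L}_k\mathcal{F}_{Bi}[\mathbf{p}])^{n+\frac12}\Big\|_{L^2}^2\le0.$$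
   Context: $SO(3)=\{\Lambda\in\mathbb{R}^{3\times3}:\Lambda^{\top}\Lambda=\mathbf{I},\ \det\Lambda=1\}$. A superscript $n$ denotes a variable at time $t=n\tau$. For a matrix field $\mathbf{p}=(\boldsymbol{n}_1,\boldsymbol{n}_2,\boldsymbol{n}_3)$ (columns), put $$\mathbf{V}_1=(0,\boldsymbol{n}_3,-\boldsymbol{n}_2),\quad\mathbf{V}_2=(-\boldsymbol{n}_3,0,\boldsymbol{n}_1),\quad\mathbf{V}_3=(\boldsymbol{n}_2,-\boldsymbol{n}_1,0);$$ $\mathbf{V}_i^{n}$ and $\mathbf{V}_i^{n+1}$ are formed from $\mathbf{p}^n$ and $\mathbf{p}^{n+1}$, and $\mathbf{V}_i^{n+\frac12}=(\mathbf{V}_i^n+\mathbf{V}_i^{n+1})/2$. For matrices, $\mathbf{a}\cdot\mathbf{b}=\sum_{i,j}a_{ij}b_{ij}$. The variational derivative is the matrix field $\frac{\delta\mathcal{F}_{Bi}}{\delta\mathbf{p}}=\big(\frac{\delta\mathcal{F}_{Bi}}{\delta\boldsymbol{n}_1},\frac{\delta\mathcal{F}_{Bi}}{\delta\boldsymbol{n}_2},\frac{\delta\mathcal{F}_{Bi}}{\delta\boldsymbol{n}_3}\big)$, and the operators of infinitesimal rotation are $$\mathscr{L}_1=\boldsymbol{n}_3\cdot\frac{\delta}{\delta\boldsymbol{n}_2}-\boldsymbol{n}_2\cdot\frac{\delta}{\delta\boldsymbol{n}_3},\quad \mathscr{L}_2=\boldsymbol{n}_1\cdot\frac{\delta}{\delta\boldsymbol{n}_3}-\boldsymbol{n}_3\cdot\frac{\delta}{\delta\boldsymbol{n}_1},\quad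 \mathscr{L}_3=\boldsymbol{n}_2\cdot\frac{\delta}{\delta\boldsymbol{n}_1}-\boldsymbol{n}_1\cdot\frac{\delta}{\delta\boldsymbol{n}_2},$$ so that $\mathscr{L}_i\mathcal{F}_{Bi}[\mathbf{p}]=\mathbf{V}_i\cdot\frac{\delta\mathcal{F}_{Bi}}{\delta\mathbf{p}}$. ''Second-order approximation'' means second order in the time step, about $t=(n+\frac12)\tau$. The constants $\chi_1,\chi_2,\chi_3>0$ are diffusion coefficients. The biaxial elastic energy is $\mathcal{F}_{Bi}[\mathbf{p}]=\int_\Omega f_{Bi}(\mathbf{p},\nabla\mathbf{p})\,d\boldsymbol{x}$ on $\Omega\subset\mathbb{R}^3$ with elastic coefficients $K_1,\dots,K_{12},\gamma_1,\gamma_2,\gamma_3$ and $$\begin{aligned}f_{Bi}=\tfrac12\Big\{&K_1(\nabla\cdot\boldsymbol{n}_1)^2+K_2(\nabla\cdot\boldsymbol{n}_2)^2+K_3(\nabla\cdot\boldsymbol{n}_3)^2+K_4(\boldsymbol{n}_1\cdot\nabla\times\boldsymbol{n}_1)^2+K_5(\boldsymbol{n}_2\cdot\nabla\times\boldsymbol{n}_2)^2+K_6(\boldsymbol{n}_3\cdot\nabla\times\boldsymbol{n}_3)^2\\&+K_7(\boldsymbol{n}_3\cdot\nabla\times\boldsymbol{n}_1)^2+K_8(\boldsymbol{n}_1\cdot\nabla\times\boldsymbol{n}_2)^2+K_9(\boldsymbol{n}_2\cdot\nabla\times\boldsymbol{n}_3)^2\\&+K_{10}(\boldsymbol{n}_2\cdot\nabla\times\boldsymbol{n}_1)^2+K_{11}(\boldsymbol{n}_3\cdot\nabla\times\boldsymbol{n}_2)^2+K_{12}(\boldsymbol{n}_1\cdot\nabla\times\boldsymbol{n}_3)^2\\&+\sum_{i=1}^3\gamma_i\,\nabla\cdot\big[(\boldsymbol{n}_i\cdot\nabla)\boldsymbol{n}_i-(\nabla\cdot\boldsymbol{n}_i)\boldsymbol{n}_i\big]\Big\}.\end{aligned}$$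 All fields are assumed regular enough that the expressions make sense. *)

(* Defs.v *)
From mathcomp Require Import all_boot all_order all_algebra.
From mathcomp Require Import all_classical all_reals all_analysis.
Set Implicit Arguments.
Unset Strict Implicit.
Unset Printing Implicit Defensive.
Import Order.TTheory GRing.Theory Num.Theory.
Import numFieldNormedType.Exports.
Local Open Scope classical_set_scope.
Local Open Scope ring_scope.

(* Indices 1, 2, 3 are encoded as 0, 1, 2 : 'I_3, and arithmetic on 'I_3 is
   modulo 3, so that (i, i + 1, i + 2) is a cyclic permutation of (1, 2, 3). *)

Notation space3 R := (R * R * R)%type.
Notation vfield R := (space3 R -> 'cV[R]_3).
Notation mfield R := (space3 R -> 'M[R]_3).

Definition vol (R : realType) : {measure set (measurableTypeR R *
    measurableTypeR R * measurableTypeR R) -> \bar R} :=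
  ((@lebesgue_measure R \x @lebesgue_measure R) \x @lebesgue_measure R)%E.

Definition SO3 (R : realType) : set 'M[R]_3 :=
  [set L | L^T *m L = 1%:M /\ \det L = 1].

Definition mdot (R : realType) (m n : nat) (a b : 'M[R]_(m, n)) : R :=
  \sum_i \sum_j a i j * b i j.

(* On an open U of a finite-dimensional V this is the usual class C^k(U). *)
Fixpoint classC (R : realType) (V : normedModType R) (k : nat) (U : set V)
    (g : V -> R) : Prop :=
  (forall x, U x -> {for x, continuous g}) /\
  if k is k'.+1 then
    forall v, (forall x, U x -> derivable g x v) /\
              classC k' U (fun x => 'D_v g x)
  else True.

Section VectorCalculus.
Variable R : realType.
Implicit Types u v : vfield R.

Definition basis3 (j : 'I_3) : space3 R :=
  ((j == 0)%:R, (j == 1)%:R, (j == 2%:R)%:R).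

Definition pderiv (j : 'I_3) (g : space3 R -> R) (x : space3 R) : R :=
  'D_(basis3 j) g x.

Definition divergence u (x : space3 R) : R :=
  \sum_j pderiv j (fun y => u y j 0) x.

Definition curl u (x : space3 R) : 'cV[R]_3 :=
  \col_i (pderiv (i + 1) (fun y => u y (i + 2%:R) 0) x
          - pderiv (i + 2%:R) (fun y => u y (i + 1) 0) x).

(* (u . nabla) v *)
Definition convect u v (x : space3 R) : 'cV[R]_3 :=
  \col_i \sum_j u x j 0 * pderiv j (fun y => v y i 0) x.

End VectorCalculus.

Record elastic_coefs (R : Type) := ElasticCoefs {
  K1 : R; K2 : R; K3 : R; K4 : R; K5 : R; K6 : R;
  K7 : R; K8 : R; K9 : R; K10 : R; K11 : R; K12 : R;
  gam : 'I_3 -> R }.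

Section Energy.
Variables (R : realType) (Omega : set (space3 R)) (K : elastic_coefs R).
Implicit Types p eta G : mfield R.

Definition elastic_density p (x : space3 R) : R :=
  let n i : vfield R := fun y => col i (p y) in
  let n1 := n 0 in let n2 := n 1 in let n3 := n 2%:R in
  2^-1 *
  (K1 K * divergence n1 x ^+ 2 + K2 K * divergence n2 x ^+ 2
   + K3 K * divergence n3 x ^+ 2
   + K4 K * mdot (n1 x) (curl n1 x) ^+ 2
   + K5 K * mdot (n2 x) (curl n2 x) ^+ 2
   + K6 K * mdot (n3 x) (curl n3 x) ^+ 2
   + K7 K * mdot (n3 x) (curl n1 x) ^+ 2
   + K8 K * mdot (n1 x) (curl n2 x) ^+ 2
   + K9 K * mdot (n2 x) (curl n3 x) ^+ 2
   + K10 K * mdot (n2 x) (curl n1 x) ^+ 2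
   + K11 K * mdot (n3 x) (curl n2 x) ^+ 2
   + K12 K * mdot (n1 x) (curl n3 x) ^+ 2
   + \sum_i gam K i *
       divergence
         (fun y => convect (n i) (n i) y - divergence (n i) y *: n i y) x).

Definition energy p : R := \int[@vol R]_(x in Omega) elastic_density p x.

Definition finite_energy p : Prop :=
  (@vol R).-integrable Omega (EFin \o elastic_density p).

Definition regular_field p : Prop :=
  (forall a i, classC 2 Omega (fun x => p x a i)) /\ finite_energy p.

Definition test_field eta : Prop :=
  (forall k a i, classC k setT (fun x => eta x a i)) /\
  exists C : set (space3 R),
    [/\ compact C, C `<=` Omega & forall x, ~ C x -> eta x = 0].

(* Continuity makes the representative of the first variation unique on the
   open set Omega. Column i of G is the variational derivative in n_i. *)
Definition is_variational_derivative p G : Prop :=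
  (forall a i x, Omega x -> {for x, continuous (fun y => G y a i)}) /\
  forall eta, test_field eta ->
    is_derive (0 : R) (1 : R) (fun e : R => energy (fun x => p x + e *: eta x))
      (\int[@vol R]_(x in Omega) mdot (G x) (eta x)).

(* Smooth curves of frames t |-> q t, with variational derivative G t at q t,
   along which the energy obeys the chain rule: since G t only sees variations
   supported inside Omega, the last clause says that the boundary conditions
   leave no boundary term. *)
Definition smooth_trajectory (q G : R -> mfield R) : Prop :=
  [/\ forall k a i,
        classC k (setT `*` Omega : set (R * space3 R)) (fun z => q z.1 z.2 a i),
      forall t x, Omega x -> SO3 (q t x),
      forall t, finite_energy (q t),
      forall t, is_variational_derivative (q t) (G t)
    & forall t, is_derive t (1 : R) (fun s => energy (q s))
        (\int[@vol R]_(x in Omega)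
           mdot (G t x) (\matrix_(a, i) 'D_1 (fun s : R => q s x a i) t))].

(* D h p p' is the approximation of the variational derivative built from the
   time step h and the values p, p' at the two ends of the step; t is the
   midpoint of the step. *)
Definition second_order_approximation
    (D : R -> mfield R -> mfield R -> mfield R) : Prop :=
  forall q G : R -> mfield R, smooth_trajectory q G ->
  forall t x, Omega x -> forall a i,
    (fun h : R => D h (q (t - h / 2)) (q (t + h / 2)) x a i - G t x a i)
      =O_ (0^'+) (fun h : R => h ^+ 2).

Definition energy_difference_relation p p' (Dn : mfield R) : Prop :=
  \int[@vol R]_(x in Omega) mdot (Dn x) (p' x - p x) = energy p' - energy p.

End Energy.

Section Scheme.
Variable R : realType.
Implicit Types (p Dn : mfield R) (chi : 'I_3 -> R).

Definition midmx (p p' : 'M[R]_3) : 'M[R]_3 := 2^-1 *: (p + p').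

(* V_1 = (0, n3, -n2), V_2 = (-n3, 0, n1), V_3 = (n2, -n1, 0) *)
Definition rotV (i : 'I_3) (p : 'M[R]_3) : 'M[R]_3 :=
  \matrix_(a, b) if b == i + 1 then p a (i + 2%:R)
                 else if b == i + 2%:R then - p a (i + 1)
                 else 0.

Definition ell p (p' : mfield R) Dn (i : 'I_3) (x : space3 R) : R :=
  mdot (midmx (rotV i (p x)) (rotV i (p' x))) (Dn x).

(* (   0        l3/chi3  -l2/chi2 )
   ( -l3/chi3     0       l1/chi1 )
   (  l2/chi2  -l1/chi1     0     ) *)
Definition rotA chi (l : 'I_3 -> R) : 'M[R]_3 :=
  \matrix_(i, j) if j == i + 1 then (chi (i + 2%:R))^-1 * l (i + 2%:R)
                 else if j == i + 2%:R then - ((chi (i + 1))^-1 * l (i + 1))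
                 else 0.

Definition gRdg_scheme (Omega : set (space3 R)) chi (tau : R)
    p (p' : mfield R) Dn : Prop :=
  forall x, Omega x ->
    tau^-1 *: (p' x - p x) =
    midmx (p x) (p' x) *m rotA chi (fun i => ell p p' Dn i x).

End Scheme.

Definition L2norm (R : realType) (Omega : set (space3 R)) (g : space3 R -> R) :
    \bar R :=
  'N[@vol R]_2%:E[EFin \o (g \_ Omega)].

(* Main.v *)
Require Import Defs.
From mathcomp Require Import all_boot all_order all_algebra.
From mathcomp Require Import ring lra.
From mathcomp Require Import all_classical all_reals all_analysis.
From mathcomp Require Import measurable_realfun.
Import Order.TTheory GRing.Theory Num.Theory.
Import numFieldNormedType.Exports.
Local Open Scope classical_set_scope.
Local Open Scope ring_scope.

(* With B = (tau / 2) A, which is skew, the scheme reads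
   p' (1 - B) = p (1 + B): p' is p times the Cayley transform of B, a rotation.
   For the energy, p A = - \sum_k chi_k^-1 l_k V_k, so pairing the scheme with
   the discrete gradient gives pointwise - tau \sum_k chi_k^-1 l_k^2, whose
   integral is the energy difference. *)

(** * The Cayley transform of a skew matrix *)

Lemma skew_quadratic_form_eq0 {R : realType} {n : nat} {B : 'M[R]_n}
    (u : 'rV[R]_n) : B^T = - B -> u *m B *m u^T = 0.
Proof.
move=> skB; set s := u *m B *m u^T.
have sT : s^T = - s.
  by rewrite /s !trmx_mul trmxK skB mulNmx mulmxN mulmxA.
(* A 1 x 1 matrix is its own transpose, so [sT] reads s = - s. *)
apply/matrixP => i j; rewrite !ord1 mxE.
have /matrixP/(_ 0 0) := sT; rewrite !mxE => h.
lra.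
Qed.

Lemma mulmx_tr_eq0 {R : realType} {n : nat} {u : 'rV[R]_n} :
  u *m u^T = 0 -> u = 0.
Proof.
move=> /matrixP/(_ 0 0); rewrite !mxE => u0.
apply/rowP => j; rewrite mxE.
have /psumr_eq0P/(_ u0)/(_ j isT) : forall k, true -> 0 <= u 0 k * (u^T) k 0.
  by move=> k _; rewrite mxE -expr2 sqr_ge0.
by rewrite mxE -expr2 => /eqP; rewrite sqrf_eq0 => /eqP.
Qed.

(** The left kernel is trivial: if u (1 - B) = 0 then u = u B, hence u u^T = u B u^T = 0. *)
Lemma skew_sub1_unitmx {R : realType} {n : nat} {B : 'M[R]_n} :
  B^T = - B -> 1%:M - B \in unitmx.
Proof.
move=> skB; rewrite -row_free_unit -kermx_eq0; apply/eqP/row_matrixP => i.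
rewrite row0; set u := row i _.
have : u *m (1%:M - B) = 0 by rewrite /u -row_mul mulmx_ker row0.
rewrite mulmxBr mulmx1 => /subr0_eq uB.
by apply: mulmx_tr_eq0; rewrite {1}uB skew_quadratic_form_eq0.
Qed.

(** For skew B the factors 1 - B and 1 + B are transposes of each other and commute, so p' (1 - B) =
    p (1 + B) carries orthogonality and determinant from p to p'. *)
Lemma SO3_cayley {R : realType} (B : 'M[R]_3) {p p' : 'M[R]_3} :
  B^T = - B -> p' - p = (p + p') *m B -> SO3 p -> SO3 p'.
Proof.
move=> skB step [pTp detp].
have unitB := skew_sub1_unitmx skB.
have tr1B : (1%:M - B)^T = 1%:M + B by rewrite linearB /= trmx1 skB opprK.
have tr1D : (1%:M + B)^T = 1%:M - B by rewrite linearD /= trmx1 skB.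
have eqp : p' *m (1%:M - B) = p *m (1%:M + B).
  rewrite mulmxBr mulmxDr !mulmx1; apply/eqP.
  by rewrite subr_eq -addrA -mulmxDl addrC -subr_eq step.
have comm : (1%:M - B) *m (1%:M + B) = (1%:M + B) *m (1%:M - B).
  by rewrite mulmxBl mul1mx [RHS]mulmxBr mulmx1 mulmxDr mulmxDl mulmx1 mul1mx.
split.
  have unitBT : (1%:M - B)^T \in unitmx by rewrite unitmx_tr.
  (* Multiplying p'^T p' = 1 by (1 - B)^T on the left and by 1 - B on the right leaves (1 - B) (1 +
     B) = (1 + B) (1 - B). *)
  apply: (can_inj (mulKmx unitBT)); apply: (can_inj (mulmxK unitB)).
  rewrite mulmx1 mulmxA -trmx_mul -mulmxA eqp trmx_mul tr1D tr1B.
  by rewrite !mulmxA -(mulmxA _ p^T) pTp mulmx1 comm.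
(* 1 + B and 1 - B have the same determinant, by transposition, and it is nonzero. *)
have := congr1 determinant eqp.
rewrite !det_mulmx detp mul1r -tr1B det_tr -[RHS]mul1r.
by apply: mulIf; rewrite -unitfE -unitmxE.
Qed.

(* Turns ordinals into their values, so that the arithmetic modulo 3 on indices
   in rotA and rotV computes. *)
Lemma ord_fun_nat {T : Type} {n : nat} (f : 'I_n.+1 -> T) :
  exists g : nat -> T, forall i, f i = g (val i).
Proof. by exists (fun k => f (inord k)) => i; rewrite inord_val. Qed.

(** * Matrix identities for [rotA] and [rotV] *)

Lemma rotA_skew {R : realType} (chi l : 'I_3 -> R) :
  (rotA chi l)^T = - rotA chi l.
Proof.
apply/matrixP => i j; rewrite !mxE.
have [c cE] := ord_fun_nat chi; have [m mE] := ord_fun_nat l.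
rewrite !cE !mE.
case: i => [[|[|[|//]]] hi]; case: j => [[|[|[|//]]] hj];
  rewrite -!val_eqE /= ?oppr0 ?opprK //.
Qed.

(** [rotV k p] is p times a constant generator of rotations, and [rotA] is minus the combination of
    these generators. This minus sign is the source of the dissipation. *)
Lemma mul_rotA {R : realType} (chi l : 'I_3 -> R) (p : 'M[R]_3) :
  p *m rotA chi l = - \sum_k ((chi k)^-1 * l k) *: rotV k p.
Proof.
apply/matrixP => a b; rewrite !mxE summxE.
rewrite !big_ord_recl !big_ord0 !mxE.
have [c cE] := ord_fun_nat chi; have [m mE] := ord_fun_nat l.
have [q qE] := ord_fun_nat (p a).
rewrite !cE !mE !qE.
case: b => [[|[|[|//]]] hb];
  rewrite -!val_eqE /= /bump /=; ring.
Qed.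

(* space3 R carries the topology, mspace3 R the sigma-algebra of vol. *)
Local Notation mspace3 R :=
  (measurableTypeR R * measurableTypeR R * measurableTypeR R)%type.

(** * Measurability of open sets and of continuous functions on space *)

Lemma ball_rat_sub {R : realType} (x : R) {e : R} : 0 < e ->
  exists q : rat, forall r : R, e <= r -> ball (ratr q : R) r x.
Proof.
move=> e0; have /rat_in_itvoo[q] : x - e < x + e by lra.
rewrite in_itv /= => /andP[h1 h2]; exists q => r er.
rewrite /ball /= ltr_norml; apply/andP; split; lra.
Qed.

(** Balls of the product are cubes, hence both open sets and measurable boxes; a rational centre and
    radius make the family countable. *)
Definition rat_ball3 (R : realType) (q : rat * rat * rat * rat) :
    set (space3 R) :=
  ball ((ratr q.1.1.1, ratr q.1.1.2, ratr q.1.2) : space3 R) (ratr q.2).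

(** If A contains the ball of radius e about x, take a rational r < e / 2 and a rational centre
    within r of x: the cube contains x and, by the triangle inequality, stays within 2 r < e of
    it. *)
Lemma open_space3_bigcup_rat {R : realType} {A : set (space3 R)} :
  open A -> A = \bigcup_(q in [set q | rat_ball3 R q `<=` A]) rat_ball3 R q.
Proof.
move=> oA; apply/seteqP; split => [x Ax|x [q qA]]; last exact: qA.
have /nbhs_ballP[e /= e0 eA] : nbhs x A by exact: open_nbhs_nbhs.
have /rat_in_itvoo[r] : 0 < e / 2 by lra.
rewrite in_itv /= => /andP[r0 re].
have [q1 h1] := ball_rat_sub x.1.1 r0.
have [q2 h2] := ball_rat_sub x.1.2 r0.
have [q3 h3] := ball_rat_sub x.2 r0.
have cx : rat_ball3 R (q1, q2, q3, r) x.
  by split; [split; [exact: h1|exact: h2]|exact: h3].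
exists (q1, q2, q3, r) => //= y cy; apply: eA.
apply: (@le_ball _ _ _ (ratr r + ratr r)); first lra.
exact: (ball_triangle (ball_sym cx) cy).
Qed.

Lemma open_measurable_space3 {R : realType} {A : set (mspace3 R)} :
  open (A : set (space3 R)) -> measurable A.
Proof.
move=> oA; rewrite (open_space3_bigcup_rat oA) bigcup_mkcond.
apply: countable_bigcupT_measurable => // q; case: ifPn => // _.
rewrite (_ : rat_ball3 R q =
  (ball (ratr q.1.1.1 : R) (ratr q.2) `*` ball (ratr q.1.1.2 : R) (ratr q.2))
   `*` ball (ratr q.1.2 : R) (ratr q.2)) //.
apply: measurableX; first apply: measurableX.
all: exact: measurable_ball.
Qed.

(** The rays ]a, +oo[ generate the Borel sets of R, and the part of the open set A that f sends into
    such a ray is open. *)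
Lemma open_continuous_measurable_space3 {R : realType} {A : set (space3 R)}
    {f : space3 R -> R} :
  open A -> (forall x, A x -> {for x, continuous f}) ->
  measurable_fun (A : set (mspace3 R)) f.
Proof.
move=> oA cf; apply: (measurability _ (RGenOInfty.measurableE R)) => //.
move=> _ [_ [a ->] <-]; apply: open_measurable_space3.
rewrite openE => x [Ax fx]; apply: filterI.
  by apply: open_nbhs_nbhs; split.
by apply: (cf x Ax); apply: open_nbhs_nbhs; split.
Qed.

(** * The squared L2 norm as an integral *)

Lemma poweR_expe {R : realType} {x : \bar R} :
  (0 <= x -> x `^ 2 = x ^+ 2)%E.
Proof.
case: x => [x||] //= x0; first by rewrite powR_mulrn.
by rewrite pnatr_eq0 mulyy.
Qed.

Lemma L2norm_sqr {R : realType} (Omega : set (space3 R)) (g : space3 R -> R) :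
  (L2norm Omega g ^+ 2 = \int[@vol R]_(x in Omega) (g x ^+ 2)%:E)%E.
Proof.
rewrite /L2norm -poweR_expe ?Lnorm_ge0// poweR_Lnorm// [RHS]integral_mkcond.
apply: eq_integral => x _ /=; rewrite !patchE.
(* Outside [Omega] the extension by zero contributes 0 to the integral over the whole space. *)
case: ifP => _ /=; last by rewrite normr0 powR0.
by rewrite powR_mulrn// real_normK// num_real.
Qed.

(** * The scheme at a point, and measurability of [ell] *)

Section Scheme.
Context {R : realType}.

Lemma mdotC (m n : nat) (a b : 'M[R]_(m, n)) : mdot a b = mdot b a.
Proof. by apply: eq_bigr => i _; apply: eq_bigr => j _; rewrite mulrC. Qed.

Lemma mdotZr (m n : nat) (a b : 'M[R]_(m, n)) c :
  mdot a (c *: b) = c * mdot a b.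
Proof.
rewrite /mdot mulr_sumr; apply: eq_bigr => i _; rewrite mulr_sumr.
by apply: eq_bigr => j _; rewrite mxE mulrCA.
Qed.

Lemma mdotDr (m n : nat) (a b c : 'M[R]_(m, n)) :
  mdot a (b + c) = mdot a b + mdot a c.
Proof.
rewrite /mdot -big_split; apply: eq_bigr => i _; rewrite -big_split.
by apply: eq_bigr => j _; rewrite mxE mulrDr.
Qed.

Lemma mdot_sumr (m n : nat) (I : Type) (s : seq I) (a : 'M[R]_(m, n)) F :
  mdot a (\sum_(k <- s) F k) = \sum_(k <- s) mdot a (F k).
Proof.
elim: s => [|k s IH]; last by rewrite !big_cons mdotDr IH.
by rewrite !big_nil -(scale0r 0) mdotZr mul0r.
Qed.

(** By linearity of V_k, the averaged V_k in [ell] is the V_k of the midpoint frame, which is the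
    one that [mul_rotA] produces. *)
Lemma rotV_midmx k (p p' : 'M[R]_3) :
  rotV k (midmx p p') = midmx (rotV k p) (rotV k p').
Proof.
apply/matrixP => a b; rewrite !mxE; do 2 case: ifP => _ //.
  by rewrite -opprD mulrN.
by rewrite addr0 mulr0.
Qed.

Lemma gRdg_step {Omega chi tau} {p p' Dn : mfield R} {x} :
  0 < tau -> gRdg_scheme Omega chi tau p p' Dn -> Omega x ->
  p' x - p x =
  tau *: (midmx (p x) (p' x) *m rotA chi (fun i => ell p p' Dn i x)).
Proof.
move=> tau0 + Ox => /(_ x Ox) <-.
by rewrite scalerA divff ?gt_eqF// scale1r.
Qed.

Lemma gRdg_SO3 {Omega chi tau} {p p' Dn : mfield R} {x} :
  0 < tau -> gRdg_scheme Omega chi tau p p' Dn -> Omega x ->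
  SO3 (p x) -> SO3 (p' x).
Proof.
move=> tau0 scheme Ox; set A := rotA chi (fun i => ell p p' Dn i x).
(* The factor 1/2 of the midpoint is moved into B, leaving p + p'. *)
apply: (SO3_cayley ((tau / 2) *: A)).
  by rewrite linearZ /= rotA_skew scalerN.
by rewrite (gRdg_step tau0 scheme Ox) -scalemxAl -scalemxAr scalerA.
Qed.

(** The step is a combination of the midpoint V_k with coefficients proportional to l_k; pairing V_k
    with [Dn] gives l_k once more, hence the squares. *)
Lemma gRdg_mdot {Omega chi tau} {p p' Dn : mfield R} {x} :
  0 < tau -> gRdg_scheme Omega chi tau p p' Dn -> Omega x ->
  mdot (Dn x) (p' x - p x) =
  - tau * \sum_k (chi k)^-1 * ell p p' Dn k x ^+ 2.
Proof.
move=> tau0 scheme Ox.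
rewrite (gRdg_step tau0 scheme Ox) mul_rotA -scaleN1r.
rewrite !mdotZr mdot_sumr mulrA mulrN1; congr (_ * _).
apply: eq_bigr => k _.
by rewrite mdotZr rotV_midmx mdotC -/(ell p p' Dn k x) -mulrA -expr2.
Qed.

Lemma measurable_ell {Omega : set (mspace3 R)} {p p' Dn : mfield R} k :
  (forall a i, measurable_fun Omega (fun x => p x a i)) ->
  (forall a i, measurable_fun Omega (fun x => p' x a i)) ->
  (forall a i, measurable_fun Omega (fun x => Dn x a i)) ->
  measurable_fun Omega (ell p p' Dn k).
Proof.
move=> mp mp' mD.
have mV (q : mfield R) a b :
    (forall a i, measurable_fun Omega (fun x => q x a i)) ->
    measurable_fun Omega (fun x => rotV k (q x) a b).
  move=> mq; under eq_fun do rewrite mxE.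
  case: (b == _); first exact: mq.
  by case: (b == _); [exact: measurableT_comp|exact: measurable_cst].
rewrite /ell /mdot; apply: measurable_sum => a; apply: measurable_sum => b.
under eq_fun do rewrite 2!mxE.
apply: measurable_funM => //; apply: measurable_funM => //.
by apply: measurable_funD; exact: mV.
Qed.

End Scheme.

Theorem mainTheorem3 (R : realType) (Omega : set (space3 R))
  (K : elastic_coefs R) (chi : 'I_3 -> R) (tau : R)
  (D : R -> mfield R -> mfield R -> mfield R) (p0 p1 : mfield R)
  (openOmega : open Omega)
  (chi_gt0 : forall i, 0 < chi i)
  (tau_gt0 : 0 < tau)
  (p0_reg : regular_field Omega K p0)
  (p1_reg : regular_field Omega K p1)
  (D_meas : forall a i, measurable_fun Omega (fun x => D tau p0 p1 x a i))
  (D_int : (@vol R).-integrable Omega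
             (fun x => (mdot (D tau p0 p1 x) (p1 x - p0 x))%:E))
  (D_order2 : second_order_approximation Omega K D)
  (D_diff : energy_difference_relation Omega K p0 p1 (D tau p0 p1))
  (p0_SO3 : forall x, Omega x -> SO3 (p0 x))
  (p1_scheme : gRdg_scheme Omega chi tau p0 p1 (D tau p0 p1)) :
  (forall x, Omega x -> SO3 (p1 x)) /\
  (((energy Omega K p1 - energy Omega K p0) / tau)%:E =
     - \sum_(k < 3) (chi k)^-1%:E *
         L2norm Omega (ell p0 p1 (D tau p0 p1) k) ^+ 2 /\
   - \sum_(k < 3) (chi k)^-1%:E *
         L2norm Omega (ell p0 p1 (D tau p0 p1) k) ^+ 2 <= 0)%E.
Proof.
split=> [x Ox|].
  exact: gRdg_SO3 tau_gt0 p1_scheme Ox (p0_SO3 x Ox).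
have chiV0 k : 0 <= (chi k)^-1 by rewrite invr_ge0 ltW.
split; last first.
  rewrite oppe_le0; apply: sume_ge0 => k _.
  by apply: mule_ge0; rewrite ?lee_fin// sqre_ge0.
have mOmega := open_measurable_space3 openOmega.
have mreg p : regular_field Omega K p ->
    forall a i, measurable_fun Omega (fun x => p x a i).
  by move=> [rp _] a i; apply: open_continuous_measurable_space3 => //;
    have [] := rp a i.
have mell k :=
  measurable_ell k (mreg _ p0_reg) (mreg _ p1_reg) D_meas.
set l := ell p0 p1 (D tau p0 p1) in mell *.
pose S x := \sum_k (chi k)^-1 * l k x ^+ 2.
have DS x : Omega x -> mdot (D tau p0 p1 x) (p1 x - p0 x) = - tau * S x.
  by move=> Ox; rewrite (gRdg_mdot tau_gt0 p1_scheme Ox).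
(* By [DS], S is - 1 / tau times the integrand of [D_int]. *)
have intS : (@vol R).-integrable Omega (EFin \o S).
  apply: eq_integrable (integrableZl mOmega (- tau^-1) D_int) => // x.
  move=> /set_mem Ox.
  by rewrite /= DS// -EFinM mulrA mulNr mulrN opprK mulVf ?gt_eqF// mul1r.
have -> : (\sum_(k < 3) (chi k)^-1%:E * L2norm Omega (l k) ^+ 2 =
           \int[@vol R]_(x in Omega) (S x)%:E)%E.
  under [RHS]eq_integral do rewrite -sumEFin.
  (* All terms are nonnegative, so sum and integral commute in the extended reals before the
     separate norms are known to be finite. *)
  rewrite ge0_integral_sum//.
  - apply: eq_bigr => k _; rewrite L2norm_sqr.
    under [RHS]eq_integral do rewrite EFinM.
    rewrite ge0_integralZl//.
    + by apply/measurable_EFinP; exact: measurable_funX.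
    + by move=> x _; rewrite lee_fin sqr_ge0.
    + by rewrite lee_fin.
  - move=> k; apply/measurable_EFinP; apply: measurable_funM => //.
    exact: measurable_funX.
  - by move=> k x _; rewrite lee_fin mulr_ge0// sqr_ge0.
have -> : energy Omega K p1 - energy Omega K p0 =
    \int[@vol R]_(x in Omega) (- tau * S x).
  by rewrite -D_diff; apply: eq_Rintegral => x /set_mem; exact: DS.
(* [energy] is a real-valued integral; since S is integrable, its extended integral is finite and
   [fine] loses nothing. *)
rewrite RintegralZl// mulNr mulNr mulrAC divff ?gt_eqF// mul1r EFinN fineK//.
exact: integrable_fin_num.
Qed.
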